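(* Let $\Delta>0$ and $\mathcal{H}_\Delta=\{\mu\in\mathbb{R}^2:|\mu_1-\mu_2|=\Delta\}$. Let $\pi$ be an explore-then-commit (ETC) strategy that is uniformly efficient on $\mathcal{H}_\Delta$. Then for all $\mu\in\mathcal{H}_\Delta$, $$\liminf_{T\to\infty} \frac{R^\pi_\mu(T)}{\log(T)}\geq \frac{1}{\Delta} .$$
   Context: Two-armed Gaussian bandit with known integer horizon $T$: at each time $t\in\{1,\dots,T\}$ the agent chooses $A_t\in\{1,2\}$ based on past observations and receives a reward $Z_t\sim\mathcal N(\mu_{A_t},1)$, where successive rewards from each arm are i.i.d. and the two arms are independent. Expectation under $\mu=(\mu_1,\mu_2)$ is denoted $\mathbb{E}_\mu$. The regret of a strategy $\pi$ is $R^\pi_\mu(T) = T \max\{\mu_1, \mu_2\} - \mathbb{E}_\mu\left[\sum_{t=1}^T \mu_{A_t}\right]$. The horizon is known to the agent, so a strategy may depend on $T$. An explore-then-commit (ETC) strategy is a pair $(\tau,\hat a)$ (which may depend on $T$), where $\tau$ is a stopping time with even values with respect to the filtration $(\mathcal{F}_t=\sigma(Z_1,\dots,Z_t))_t$ and $\hat a\in\{1,2\}$ is $\mathcal{F}_\tau$-measurable. At time $t$ it plays $A_t=1$ if $t\le\tau$ and $t$ is odd, $A_t=2$ if $t\le\tau$ and $t$ is even, and $A_t=\hat a$ if $t>\tau$. A strategy $\pi$ is uniformly efficient on a set $\mathcal S\subset\mathbb{R}^2$ if for all $\mu\in\mathcal S$ and all $\alpha>0$, $R_\mu^\pi(T)=o(T^\alpha)$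 as $T\to\infty$. *)

(* Defs.v *)
From HB Require Import structures.
From mathcomp Require Export all_boot all_order all_algebra.
From mathcomp Require Export finmap.
From mathcomp Require Export all_classical all_reals all_analysis.

Set Implicit Arguments.
Unset Strict Implicit.
Unset Printing Implicit Defensive.

Export Order.TTheory GRing.Theory Num.Theory.
Export numFieldNormedType.Exports.

Open Scope classical_set_scope.
Open Scope ring_scope.

Notation arm := 'I_2.
Notation arm1 := (ord0 : arm).
Notation arm2 := (ord_max : arm).

Definition mutually_independent d (Omega : measurableType d) (R : realType)
    (Pr : probability Omega R) (I : choiceType) (X : I -> Omega -> R) : Prop :=
  forall (J : {fset I}) (B : I -> set R),
    (forall i, measurable (B i)) ->
    Pr (\bigcap_(i in [set` J]) (X i @^-1` B i)) =
    (\prod_(i <- J) Pr (X i @^-1` B i))%E.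

(* [X a k] is the (k+1)-st reward drawn from arm [a].  The rewards are fixed
   functions on one measurable space and only the measure [P mu] depends on the
   means, so that a strategy cannot depend on the unknown [mu]. *)
Definition gaussian_bandit d (Omega : measurableType d) (R : realType)
    (P : (arm -> R) -> probability Omega R)
    (X : arm -> nat -> {mfun Omega >-> R}) : Prop :=
  forall mu : arm -> R,
    (forall a k (B : set R), measurable B ->
       distribution (P mu) (X a k) B = normal_prob (mu a) 1 B) /\
    mutually_independent (P mu)
      (fun ak : arm * nat => X ak.1 ak.2 : Omega -> R).

Section Interaction.
Context d (Omega : measurableType d) (R : realType).
Variables (X : arm -> nat -> {mfun Omega >-> R}) (A : nat -> Omega -> arm).

(* Time starts at 1; the values at time 0 are never used. *)
Definition nb_past_pulls (a : arm) (t : nat) (w : Omega) : nat :=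
  (\sum_(1 <= s < t) (A s w == a))%N.

Definition reward (t : nat) (w : Omega) : R :=
  X (A t w) (nb_past_pulls (A t w) t w) w.

(* The sigma-algebra generated by the rewards at times 1, ..., t. *)
Definition history (t : nat) : set (set Omega) :=
  g_sigma_preimage (fun s : 'I_t => reward s.+1).

End Interaction.

Definition is_stopping_time (Omega : Type) (F : nat -> set (set Omega))
    (tau : Omega -> nat) : Prop :=
  forall t, F t [set w | (tau w <= t)%N].

Definition stopped_sigma_algebra (Omega : Type) (F : nat -> set (set Omega))
    (tau : Omega -> nat) : set (set Omega) :=
  [set E | forall t, F t (E `&` [set w | (tau w <= t)%N])].

Definition etc_action (Omega : Type) (tau : Omega -> nat) (ahat : Omega -> arm)
    (t : nat) (w : Omega) : arm :=
  if (t <= tau w)%N then (if odd t then arm1 else arm2) else ahat w.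

(* The filtration is the one generated by the rewards that the ETC rule
   (tau, ahat) itself collects. *)
Definition is_etc d (Omega : measurableType d) (R : realType)
    (X : arm -> nat -> {mfun Omega >-> R})
    (tau : Omega -> nat) (ahat : Omega -> arm) : Prop :=
  let F := history X (etc_action tau ahat) in
  [/\ is_stopping_time F tau,
      forall w, ~~ odd (tau w) &
      forall a, stopped_sigma_algebra F tau (ahat @^-1` [set a])].

Definition regret d (Omega : measurableType d) (R : realType)
    (P : (arm -> R) -> probability Omega R)
    (A : nat -> Omega -> arm) (mu : arm -> R) (T : nat) : R :=
  T%:R * Num.max (mu arm1) (mu arm2) -
  fine ('E_(P mu)[(fun w => \sum_(1 <= t < T.+1) mu (A t w))%R])%E.

(* The strategy may depend on the horizon: [pi T t] is the arm played at time
   [t] when the horizon is [T]. *)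
Definition uniformly_efficient d (Omega : measurableType d) (R : realType)
    (P : (arm -> R) -> probability Omega R) (S : set (arm -> R))
    (pi : nat -> nat -> Omega -> arm) : Prop :=
  forall mu, S mu -> forall alpha : R, 0 < alpha ->
    (fun T : nat => regret P (pi T) mu T : R^o) =o_\oo
    (fun T : nat => T%:R `^ alpha : R^o).

Definition known_gap (R : realType) (Delta : R) : set (arm -> R) :=
  [set mu | `|mu arm1 - mu arm2| = Delta].

(* Main.v *)
From HB Require Import structures.
From mathcomp Require Import ring lra zify.
From mathcomp Require Import measurable_realfun.
Require Import Defs.

Set Implicit Arguments.
Unset Strict Implicit.
Unset Printing Implicit Defensive.

(** Why the bound holds.  Let mu' be mu with the two means exchanged: it lies in
    the same class H_Delta, and the strategy has to commit to opposite arms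
    under mu and under mu'.  Until it commits, every pull, of either arm, shifts
    the law of one reward by Delta, so it contributes Delta^2 / 2 to the
    Kullback-Leibler divergence between the two experiments.  Uniform efficiency
    makes the probability of committing to the wrong arm o(T^(alpha - 1)) for
    every alpha > 0, and telling mu from mu' so reliably requires a divergence
    of about ln T, hence about 2 ln T / Delta^2 exploration pulls.  Exploration
    alternates between the arms, so half of these pulls cost Delta each: the
    regret is at least about ln T / Delta.

    The precise form.  Cap the exploration time at N = 2 M with M about T / 4,
    put sigma = min (tau, N), let E be the event that the strategy commits to
    the best arm of mu by time N, and let Z be the log-likelihood ratio of the
    first sigma rewards.  From exp x >= 1 + x, for every real c,
    exp (c 1_E - Z) >= 1 + c 1_E - Z.  Integrating under mu gives
    ([error_tradeoff], a form of the Donsker-Varadhan inequality)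

      c P_mu(E) <= Delta^2 / 2 * E_mu[sigma] + exp c * P_mu'(E).

    The integration uses two facts about sequences of independent Gaussian
    variables stopped at sigma: the weight exp (-Z) turns P_mu into P_mu'
    ([change_of_measure_stopped]), and the mean of Z is given by Wald's identity
    ([wald]).  They apply to the bandit because, as long as exploration lasts,
    the rewards collected are a fixed i.i.d.-by-arm sequence that does not
    depend on the strategy ([observed_history]).

    Each of the three quantities above is controlled by the number of pulls of
    the wrong arm, hence by a regret ([regret_tradeoff]): sigma is at most twice
    that number, the complement of E forces at least M wrong pulls under mu, and
    E forces at least M wrong pulls under mu'.  Taking c = (1 - eps) ln T, the
    bounds R_mu = o(T) and R_mu' = o(T^eps) give P_mu(E) -> 1 and
    exp c * P_mu'(E) -> 0, so that Delta R_mu >= (1 - O(eps)) ln T. *)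

Definition mfun_of d d' (T : measurableType d) (U : measurableType d')
    (f : T -> U) (mf : measurable_fun [set: T] f) : {mfun T >-> U} :=
  HB.pack f (isMeasurableFun.Build _ _ _ _ _ mf).

(** * Gaussian laws with unit variance *)

Section normal_density.
Context {R : realType}.
Local Notation leb := lebesgue_measure.

Lemma normal_pdf1E (m x : R) :
  normal_pdf m 1 x = normal_peak 1 * expR (- (x - m) ^+ 2 / 2).
Proof. by rewrite normal_pdfE ?oner_neq0// /normal_fun expr1n. Qed.

(** [normal_prob] is defined by its density only on sets; Radon-Nikodym extends
    this to functions. *)
Lemma ge0_integral_normal_prob (m : R) (h : R -> \bar R) (B : set R) :
  measurable B -> measurable_fun [set: R] h -> (forall x, 0 <= h x)%E ->
  (\int[normal_prob m 1]_(x in B) h x =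
   \int[leb]_(x in B) (h x * (normal_pdf m 1 x)%:E))%E.
Proof.
move=> mB mh h0.
have dom := normal_prob_dominates m (1 : R).
pose rn := Radon_Nikodym_SigmaFinite.f (normal_prob m 1) leb.
have mrn : measurable_fun [set: R] rn.
  exact: measurable_int (Radon_Nikodym_SigmaFinite.f_integrable dom).
have mpdf : measurable_fun [set: R] (fun x => (normal_pdf m 1 x)%:E).
  by apply/measurable_EFinP; exact: measurable_normal_pdf.
rewrite -(Radon_Nikodym_SigmaFinite.change_of_variables dom)//; last first.
  exact: measurable_funTS.
apply: ae_eq_integral => //.
- by apply: measurable_funTS; exact: emeasurable_funM.
- by apply: measurable_funTS; exact: emeasurable_funM.
apply: ae_eqe_mul2l; apply: integral_ae_eq => //.
- apply: (integrableS measurableT) => //.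
  exact: Radon_Nikodym_SigmaFinite.f_integrable dom.
- exact: measurable_funTS.
- by move=> A _ mA; rewrite -Radon_Nikodym_SigmaFinite.f_integral.
Qed.

(** The logarithm of the ratio of the densities of N(a, 1) and N(b, 1) at y. *)
Definition llr (a b y : R) : R := (a - b) * (y - (a + b) / 2).

Lemma measurable_llr (a b : R) : measurable_fun [set: R] (llr a b).
Proof. by apply: measurable_funM => //; exact: measurable_funB. Qed.

Lemma normal_prob_change (a b : R) (B : set R) : measurable B ->
  (\int[normal_prob a 1]_(x in B) (expR (- llr a b x))%:E =
   normal_prob b 1 B)%E.
Proof.
move=> mB; rewrite ge0_integral_normal_prob//; last first.
  apply/measurable_EFinP; apply: measurableT_comp => //.
  by apply: measurableT_comp => //; exact: measurable_llr.
apply: eq_integral => x _; rewrite -EFinM; congr EFin.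
rewrite !normal_pdf1E mulrCA -expRD; congr (_ * expR _).
by rewrite /llr; field.
Qed.

Lemma integral_normal_cst (a r : R) : (\int[normal_prob a 1]_x r%:E = r%:E)%E.
Proof.
rewrite integral_cst// -[RHS]mule1; congr (_ * _)%E.
exact: (@probability_setT _ _ _ (normal_prob a 1)).
Qed.

Lemma expR_ge_norm (x : R) : `|x| <= expR x + expR (- x).
Proof.
have h (y : R) : y <= expR y by have := expR_ge1Dx y; lra.
by rewrite ler_norml; apply/andP; split;
  have := h x; have := h (- x); have := expR_ge0 x; have := expR_ge0 (- x); lra.
Qed.

Lemma integrable_expR_llr (a b : R) :
  (normal_prob a 1).-integrable [set: R] (fun x => (expR (- llr a b x))%:E).
Proof.
apply/integrableP; split.
  apply/measurable_EFinP; apply: measurableT_comp => //.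
  by apply: measurableT_comp => //; exact: measurable_llr.
under eq_integral do rewrite gee0_abs ?lee_fin ?expR_ge0//.
by rewrite normal_prob_change// probability_setT ltry.
Qed.

(** |x - a| is dominated by exp (x - a) + exp (a - x), and the two exponentials
    are, up to a constant, likelihood ratios of N(a, 1) against N(a + 1, 1) and
    N(a - 1, 1). *)
Lemma integrable_normal_sub (a : R) :
  (normal_prob a 1).-integrable [set: R] (fun x => (x - a)%:E).
Proof.
have mB : measurable_fun [set: R] (fun x : R => x - a).
  exact: measurable_funB.
pose g (b x : R) : \bar R := ((expR (1 / 2))%:E * (expR (- llr a b x))%:E)%E.
have ig b : (normal_prob a 1).-integrable [set: R] (g b).
  by apply: integrableZl => //; exact: integrable_expR_llr.
apply: (le_integrable _ _ _ (integrableD _ (ig (a + 1)) (ig (a - 1)))) => //.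
  exact/measurable_EFinP.
move=> x _; rewrite /g -!EFinM -EFinD !abse_EFin lee_fin -!expRD.
apply: le_trans (ler_norm _).
rewrite (_ : _ + - llr a (a + 1) x = x - a); last by rewrite /llr; field.
rewrite (_ : _ + - llr a (a - 1) x = - (x - a)); last by rewrite /llr; field.
exact: expR_ge_norm.
Qed.

(** The likelihood ratio of N(a, 1) against N(a + t, 1) has integral 1 and lies
    above its tangent line, so 1 + t M - t^2 / 2 <= 1 for every t, where M is
    the mean of x - a.  Taking t = M forces M = 0. *)
Lemma mean_normal_sub (a : R) :
  (\int[normal_prob a 1]_x (x - a)%:E = 0)%E.
Proof.
have iB := integrable_normal_sub a.
have := integrable_fin_num measurableT iB.
set M := (\int[_]_x _)%E => /fineK ME.
suff H t : t * fine M <= t ^+ 2 / 2.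
  rewrite -ME; congr EFin; have := H (fine M).
  by have := sqr_ge0 (fine M); rewrite expr2 => ? ?; nra.
suff : ((1 - t ^+ 2 / 2 + t * fine M)%:E <= 1)%E by rewrite lee_fin; lra.
have i1 : (normal_prob a 1).-integrable [set: R] (cst (1 - t ^+ 2 / 2)%:E).
  exact: finite_measure_integrable_cst.
have i2 : (normal_prob a 1).-integrable [set: R] (fun x => t%:E * (x - a)%:E)%E.
  exact: integrableZl.
have <- : (\int[normal_prob a 1]_x ((1 - t ^+ 2 / 2)%:E + t%:E * (x - a)%:E) =
    (1 - t ^+ 2 / 2 + t * fine M)%:E)%E.
  rewrite integralD//= integral_normal_cst integralZl//.
  by rewrite -/M -ME -EFinM -EFinD.
have <- : (\int[normal_prob a 1]_x (expR (- llr a (a + t) x))%:E = 1)%E.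
  rewrite normal_prob_change//.
  exact: (@probability_setT _ _ _ (normal_prob (a + t) 1)).
apply: le_integral => //.
- exact: integrableD.
- exact: integrable_expR_llr.
move=> x _; rewrite -EFinM -EFinD lee_fin.
apply: le_trans (expR_ge1Dx _); rewrite /llr; lra.
Qed.

Lemma llrE (a b y : R) : llr a b y = (a - b) ^+ 2 / 2 + (a - b) * (y - a).
Proof. by rewrite /llr; field. Qed.

Lemma integrable_llr (a b : R) :
  (normal_prob a 1).-integrable [set: R] (fun x => (llr a b x)%:E).
Proof.
under eq_fun do rewrite llrE EFinD (EFinM (a - b)).
apply: integrableD => //; first exact: finite_measure_integrable_cst.
by apply: integrableZl => //; exact: integrable_normal_sub.
Qed.

(** This is the Kullback-Leibler divergence of N(a, 1) from N(b, 1): the part of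
    the log-likelihood ratio that is linear in x - a averages out. *)
Lemma mean_llr (a b : R) :
  (\int[normal_prob a 1]_x (llr a b x)%:E = ((a - b) ^+ 2 / 2)%:E)%E.
Proof.
under eq_integral do rewrite llrE EFinD (EFinM (a - b)).
have iB := integrable_normal_sub a.
rewrite integralD//; last 2 first.
- exact: finite_measure_integrable_cst.
- exact: integrableZl.
by rewrite integral_normal_cst integralZl// mean_normal_sub mule0 adde0.
Qed.

End normal_density.

(** * Expectations under independence *)

Section independence.
Context d (T : measurableType d) (R : realType) (P : probability T R).

(** Independence says that the joint law of U and V is a product measure, to
    which Tonelli's theorem applies. *)
Lemma ge0_integralM_indep (U V : {mfun T >-> R}) :
  (forall A B : set R, measurable A -> measurable B ->
     P (U @^-1` A `&` V @^-1` B) = (P (U @^-1` A) * P (V @^-1` B))%E) ->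
  (forall w, 0 <= U w) -> (forall w, 0 <= V w) ->
  (\int[P]_w (U w * V w)%:E = (\int[P]_w (U w)%:E) * (\int[P]_w (V w)%:E))%E.
Proof.
move=> indep U0 V0.
pose UV w := (U w, V w).
have mUV : measurable_fun [set: T] UV by exact/measurable_fun_pair.
pose UVm := mfun_of mUV.
(* absolute values keep the integrand nonnegative off the range of U and V *)
pose f (z : R * R) : \bar R := (`|z.1| * `|z.2|)%:E.
have mf : measurable_fun [set: R * R] f.
  apply/measurable_EFinP; apply: measurable_funM.
    by apply: measurableT_comp => //; exact: measurable_fst.
  by apply: measurableT_comp => //; exact: measurable_snd.
have f0 z : (0 <= f z)%E by rewrite lee_fin mulr_ge0.
transitivity (\int[distribution P UVm]_z f z)%E.
  rewrite ge0_integral_distribution//; apply: eq_integral => w _ /=.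
  by rewrite /f /= !ger0_norm.
have -> : (\int[distribution P UVm]_z f z =
           \int[(distribution P U \x distribution P V)%E]_z f z)%E.
  apply: eq_measure_integral => A mA _; apply/esym.
  by apply: product_measure_unique => // B C mB mC; exact: indep.
rewrite fubini_tonelli1//.
have mN : measurable_fun [set: R] (fun x : R => `|x|%:E).
  by apply/measurable_EFinP; exact: normr_measurable.
have dist (W : {mfun T >-> R}) : (forall w, 0 <= W w) ->
    (\int[distribution P W]_y `|y|%:E = \int[P]_w (W w)%:E)%E.
  move=> W0; rewrite ge0_integral_distribution//; apply: eq_integral => w _ /=.
  by rewrite ger0_norm.
rewrite /fubini_F -(dist U)// -(dist V)//.
transitivity (\int[distribution P U]_x
    (`|x|%:E * \int[distribution P V]_y `|y|%:E))%E.
  apply: eq_integral => x _; rewrite -ge0_integralZl//.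
rewrite ge0_integralZr//.
by apply: integral_ge0.
Qed.

(** The previous lemma applies to the indicator of A and to the positive and
    negative parts of V. *)
Lemma integral_setI_indep (A : set T) (V : {mfun T >-> R}) :
  measurable A -> P.-integrable setT (EFin \o V) ->
  (forall B : set R, measurable B ->
     P (A `&` V @^-1` B) = (P A * P (V @^-1` B))%E) ->
  (\int[P]_(w in A) (V w)%:E = P A * \int[P]_w (V w)%:E)%E.
Proof.
move=> mA iV indep.
have mI : measurable_fun [set: T] (\1_A : T -> R) by exact: measurable_indic.
pose I := mfun_of mI.
have pos (g : R -> R) : measurable_fun [set: R] g -> (forall x, 0 <= g x) ->
    (\int[P]_(w in A) (g (V w))%:E = P A * \int[P]_w (g (V w))%:E)%E.
  move=> mg g0.
  have mgV : measurable_fun [set: T] (g \o V) by exact: measurableT_comp.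
  pose gV := mfun_of mgV.
  have -> : (\int[P]_(w in A) (g (V w))%:E = \int[P]_w (I w * gV w)%:E)%E.
    rewrite integral_mkcond; apply: eq_integral => w _ /=.
    by rewrite patchE indicE; case: ifPn => _; rewrite (mul1r, mul0r).
  have -> : P A = (\int[P]_w (I w)%:E)%E by rewrite integral_indic// setIT.
  apply: ge0_integralM_indep => [B C mB mC|w|w]; last exact: g0.
  - have mC' : measurable (g @^-1` C) by rewrite -[_ @^-1` _]setTI; exact: mg.
    have mV : measurable (V @^-1` (g @^-1` C)).
      by rewrite -[_ @^-1` _]setTI; exact: measurable_funP.
    rewrite preimage_indic (_ : gV @^-1` C = V @^-1` (g @^-1` C))//.
    case: ifPn => _; case: ifPn => _.
    + by rewrite setTI probability_setT mul1e.
    + exact: indep.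
    + rewrite probability_setC// muleBl ?mul1e; last 2 first.
      * exact: fin_num_measure.
      * by rewrite fin_num_adde_defl// fin_numN fin_num_measure.
      rewrite setIC -setDE measureD//; last by rewrite ltey_eq fin_num_measure.
      congr (_ - _)%E; rewrite setIC; exact: indep.
    + by rewrite set0I measure0 mul0e.
  - by rewrite /I/= indicE; case: (_ \in _).
rewrite [LHS]integralE [in RHS]integralE muleBr; last 2 first.
- exact: fin_num_measure.
- by rewrite fin_num_adde_defr//; exact: integrable_pos_fin_num.
congr (_ - _)%E.
- under eq_integral do rewrite funeposE/= -EFin_max.
  under [in RHS]eq_integral do rewrite funeposE/= -EFin_max.
  apply: (pos (fun x => Num.max x 0)); first exact: measurable_maxr.
  by move=> x; rewrite le_max lexx orbT.
- under eq_integral do rewrite funenegE/= -EFin_max.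
  under [in RHS]eq_integral do rewrite funenegE/= -EFin_max.
  apply: (pos (fun x => Num.max (- x) 0)); first exact: measurable_maxr.
  by move=> x; rewrite le_max lexx orbT.
Qed.

End independence.

(** * The sigma-algebras of the successive observations *)

Section observations.
Context d (T : measurableType d) (R : realType) (Y : nat -> {mfun T >-> R}).

Definition rectangle n (B : nat -> set R) : set T :=
  \bigcap_(s in `I_n) (Y s @^-1` B s).

Definition rectangles n : set_system T :=
  [set A | exists2 B : nat -> set R,
    (forall s, measurable (B s)) & A = rectangle n B].

(** The rectangles form a pi-system, so a finite measure on this sigma-algebra
    is determined by its values on rectangles. *)
Definition observed n : set_system T := <<s rectangles n >>.

Lemma rectangle0 B : rectangle 0 B = setT.
Proof. by rewrite /rectangle II0 bigcap_set0. Qed.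

Lemma rectangleS n B : rectangle n.+1 B = rectangle n B `&` Y n @^-1` B n.
Proof. by rewrite /rectangle IIS bigcap_setU bigcap_set1. Qed.

Lemma eq_rectangle n B B' : (forall s, (s < n)%N -> B s = B' s) ->
  rectangle n B = rectangle n B'.
Proof. by move=> BB'; apply: eq_bigcapr => s /BB' ->. Qed.

Lemma rectangle_pad m n B : (m <= n)%N ->
  rectangle m B = rectangle n (fun s => if (s < m)%N then B s else setT).
Proof.
move=> mn; apply/seteqP; split => w H s /= sn; last first.
  by have := H s; rewrite /= sn; apply; exact: leq_trans mn.
by case: ifPn => // sm; exact: H.
Qed.

Lemma rectangles_setI n : setI_closed (rectangles n).
Proof.
move=> _ _ [B mB ->] [C mC ->]; exists (fun s => B s `&` C s).
  by move=> s; exact: measurableI.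
by rewrite /rectangle -bigcapI.
Qed.

Lemma measurable_rectangle n B : (forall s, measurable (B s)) ->
  measurable (rectangle n B).
Proof.
move=> mB; elim: n => [|n ih]; first by rewrite rectangle0.
rewrite rectangleS; apply: measurableI => //.
by rewrite -[_ @^-1` _]setTI; exact: measurable_funP.
Qed.

Lemma rectangles_setT n : rectangles n setT.
Proof.
exists (fun=> setT) => //.
by apply/seteqP; split => w // _ s.
Qed.

Lemma observed_measurable n : observed n `<=` measurable.
Proof.
apply: smallest_sub; first exact: sigma_algebra_measurable.
by move=> _ [B mB ->]; exact: measurable_rectangle.
Qed.

Lemma observed_mono m n : (m <= n)%N -> observed m `<=` observed n.
Proof.
move=> mn; apply: smallest_sub; first exact: smallest_sigma_algebra.
move=> _ [B mB ->]; apply: sub_sigma_algebra.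
exists (fun s => if (s < m)%N then B s else setT); last exact: rectangle_pad.
by move=> s; case: ifP.
Qed.

Lemma observed_preimage s n (B : set R) : (s < n)%N -> measurable B ->
  observed n (Y s @^-1` B).
Proof.
move=> sn mB; apply: (observed_mono sn); apply: sub_sigma_algebra.
exists (fun t => if t == s then B else setT); first by move=> t; case: ifP.
rewrite rectangleS eqxx (@eq_rectangle _ _ (fun=> setT)).
  by rewrite -{1}[LHS]setTI; congr (_ `&` _); apply/seteqP; split => w // _ ?.
by move=> t ts; rewrite ifF//; apply/eqP => ts'; rewrite ts' ltnn in ts.
Qed.

(* The sample space with the observed sigma-algebra as its measurable structure,
   so that the closure properties of measurable functions apply to it. *)
Notation obsType n := (g_sigma_algebraType (rectangles n)).

Lemma observed_fun n (f : T -> R) (B : set R) :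
  measurable_fun [set: obsType n] (f : obsType n -> R) -> measurable B ->
  observed n (f @^-1` B).
Proof. by move=> mf mB; have := mf measurableT B mB; rewrite setTI. Qed.

Lemma observed_funP s n : (s < n)%N ->
  measurable_fun [set: obsType n] (Y s : obsType n -> R).
Proof. by move=> sn _ B mB; rewrite setTI; exact: observed_preimage. Qed.

End observations.
Notation obsType Y n := (g_sigma_algebraType (rectangles Y n)).

(** * Change of measure between Gaussian sequences *)

Section change_of_measure.
Context d (T : measurableType d) (R : realType) (Y : nat -> {mfun T >-> R}).

(** Independence and the individual laws in one formula: taking the sides of the
    rectangle equal to [setT] but one isolates the law of that variable. *)
Definition gaussian_sequence (P : probability T R) (a : nat -> R) : Prop :=
  forall n B, (forall s, measurable (B s)) ->
  P (rectangle Y n B) = (\prod_(s < n) normal_prob (a s) 1 (B s))%E.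

Lemma gaussian_sequence_law P a n (B : set R) :
  gaussian_sequence P a -> measurable B ->
  P (Y n @^-1` B) = normal_prob (a n) 1 B.
Proof.
move=> gP mB; have := gP n.+1 (fun s => if s == n then B else setT).
rewrite rectangleS big_ord_recr/= eqxx big1 ?mul1e; last first.
  move=> s _; rewrite ltn_eqF//.
  exact: (@probability_setT _ _ _ (normal_prob (a s) 1)).
move=> <-; last by move=> s; case: ifP.
rewrite -[in LHS](setTI (Y n @^-1` B)) (@eq_rectangle _ _ _ _ _ _ (fun=> setT)).
  congr (P (_ `&` _)); apply/seteqP; split => w // _ ?.
by move=> s sn; rewrite ltn_eqF.
Qed.

(** Both sides are finite measures of A that agree on rectangles. *)
Lemma gaussian_sequence_indep P a n (A : set T) (B : set R) :
  gaussian_sequence P a -> observed Y n A -> measurable B ->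
  P (A `&` Y n @^-1` B) = (P A * P (Y n @^-1` B))%E.
Proof.
move=> gP oA mB.
have mYB : measurable (Y n @^-1` B).
  by rewrite -[_ @^-1` _]setTI; exact: measurable_funP.
have r0 : 0 <= fine (P (Y n @^-1` B)) by exact: fine_ge0.
pose m1 : {measure set T -> \bar R} := mrestr P mYB.
pose m2 : {measure set T -> \bar R} := mscale (NngNum r0) P.
rewrite -[LHS]/(m1 A).
rewrite (_ : (P A * _)%E = m2 A); last first.
  rewrite muleC /m2/= /mscale/=; congr (_ * _)%E; apply/esym/fineK.
  exact: fin_num_measure.
apply: (g_sigma_algebra_measure_unique (rectangles Y n) _ (fun=> setT)) => //.
- by move=> _ [C mC ->]; exact: measurable_rectangle.
- by move=> _; exact: rectangles_setT.
- by rewrite bigcup_const.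
- exact: rectangles_setI.
- move=> _ [C mC ->]; rewrite /m1 /m2/= /mscale /mrestr/=.
  rewrite [X in (X * _)%E](_ : _ = P (Y n @^-1` B)); last first.
    by apply: fineK; exact: fin_num_measure.
  pose C' s := if (s < n)%N then C s else B.
  rewrite (@eq_rectangle _ _ _ _ _ _ C'); last by move=> s; rewrite /C' => ->.
  have -> : rectangle Y n C' `&` Y n @^-1` B = rectangle Y n.+1 C'.
    by rewrite rectangleS /C' ltnn.
  rewrite !gP// => [|s|s]; [|by rewrite /C'; case: ifP..].
  by rewrite big_ord_recr/= muleC /C' ltnn (gaussian_sequence_law _ gP).
- by move=> _; rewrite /m1/= /mrestr/= setTI ltey_eq fin_num_measure.
Qed.

Variables (P Q : probability T R) (a b : nat -> R).
Hypotheses (gP : gaussian_sequence P a) (gQ : gaussian_sequence Q b).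

Lemma integral_gaussian_sequence n (f : R -> \bar R) :
  measurable_fun [set: R] f -> (forall y, 0 <= f y)%E ->
  (\int[P]_w f (Y n w) = \int[normal_prob (a n) 1]_y f y)%E.
Proof.
move=> mf f0.
(* [normal_prob] is a measure for the structure [measurableTypeR R], whose
   display differs from the one in the type of [Y n]. *)
have mY : measurable_fun [set: T] (Y n : T -> measurableTypeR R).
  by move=> _ B mB; exact: measurable_funP.
pose Z := mfun_of mY.
rewrite -(@ge0_integral_distribution _ _ _ _ _ P Z)//.
by apply: eq_measure_integral => A mA _; exact: gaussian_sequence_law gP mA.
Qed.

Definition cumulative_llr n w : R := \sum_(s < n) llr (a s) (b s) (Y s w).

Lemma measurable_cumulative_llr n :
  measurable_fun [set: obsType Y n] (cumulative_llr n : obsType Y n -> R).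
Proof.
apply: measurable_sum => s.
apply: measurableT_comp; first exact: measurable_llr.
exact: observed_funP.
Qed.

Lemma measurable_obsT n (f : T -> R) :
  measurable_fun [set: obsType Y n] (f : obsType Y n -> R) ->
  measurable_fun [set: T] f.
Proof.
move=> mf _ B mB; rewrite setTI.
by apply: (@observed_measurable _ _ _ Y n); exact: observed_fun.
Qed.

(** Over a rectangle the weight is a product of independent factors, one for
    each observation, each of them computed by [normal_prob_change]. *)
Lemma change_of_measure_rectangle n B : (forall s, measurable (B s)) ->
  (\int[P]_(w in rectangle Y n B) (expR (- cumulative_llr n w))%:E =
   Q (rectangle Y n B))%E.
Proof.
move=> mB; rewrite gQ//; elim: n => [|n ih].
  rewrite rectangle0 big_ord0 (eq_integral (cst 1%E)).
    by rewrite integral_cst// mul1e; exact: probability_setT.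
  by move=> w _; rewrite /cumulative_llr big_ord0 oppr0 expR0.
pose u (w : T) : R := \1_(rectangle Y n B) w * expR (- cumulative_llr n w).
pose v (y : R) : R := \1_(B n) y * expR (- llr (a n) (b n) y).
have mu : measurable_fun [set: obsType Y n] (u : obsType Y n -> R).
  apply: measurable_funM.
    apply: measurable_indic; apply: sub_sigma_algebra; exact: (ex_intro2 _ _ B).
  apply: measurableT_comp => //; apply: measurableT_comp => //.
  exact: measurable_cumulative_llr.
have mv : measurable_fun [set: R] v.
  apply: measurable_funM; first exact: measurable_indic.
  apply: measurableT_comp => //; apply: measurableT_comp => //.
  exact: measurable_llr.
have mvY : measurable_fun [set: T] (v \o Y n) by exact: measurableT_comp.
pose U := mfun_of (measurable_obsT mu).
pose V := mfun_of mvY.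
have indic_ge0 S (X : set S) (x : S) : 0 <= \1_X x :> R.
  by rewrite indicE; case: (_ \in _).
have u0 w : 0 <= u w by rewrite mulr_ge0 ?expR_ge0.
have v0 y : 0 <= v y by rewrite mulr_ge0 ?expR_ge0.
transitivity (\int[P]_w (U w * V w)%:E)%E.
  rewrite integral_mkcond; apply: eq_integral => w _.
  rewrite patchE /U /V /= /u /v/= rectangleS in_setI !indicE.
  rewrite /cumulative_llr big_ord_recr/= opprD expRD.
  have -> : (w \in Y n @^-1` B n) = (Y n w \in B n).
    by apply/idP/idP; rewrite !inE.
  by case: (w \in _); case: (_ \in _); rewrite ?(mul0r,mul1r,mulr0).
rewrite ge0_integralM_indep; last 3 first.
- move=> C D mC mD; apply: (gaussian_sequence_indep (B := v @^-1` D) gP).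
  + exact: observed_fun.
  + by rewrite -[_ @^-1` _]setTI; exact: mv.
- exact: u0.
- by move=> w; exact: v0.
rewrite big_ord_recr/= -ih; congr (_ * _)%E.
  rewrite [RHS]integral_mkcond; apply: eq_integral => w _.
  by rewrite patchE /U/= /u indicE; case: ifP; rewrite ?(mul0r,mul1r).
rewrite (integral_gaussian_sequence n (f := EFin \o v))//; last first.
  exact/measurable_EFinP.
rewrite -(normal_prob_change (a n))// [RHS]integral_mkcond.
apply: eq_integral => y _.
by rewrite patchE/= /v indicE; case: ifP; rewrite ?(mul0r,mul1r).
Qed.

(** As the integral of a density, the left-hand side is a finite measure of A,
    so the formula extends from the pi-system of rectangles. *)
Lemma change_of_measure n (A : set T) : observed Y n A ->
  (\int[P]_(w in A) (expR (- cumulative_llr n w))%:E = Q A)%E.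
Proof.
have mL : measurable_fun [set: T] (fun w => (expR (- cumulative_llr n w))%:E).
  apply/measurable_EFinP; apply: measurable_obsT.
  apply: measurableT_comp => //; apply: measurableT_comp => //.
  exact: measurable_cumulative_llr.
pose L A := (\int[P]_(w in A) (expR (- cumulative_llr n w))%:E)%E.
have L0 : L set0 = 0%E by exact: integral_set0.
have L_ge0 B : (0 <= L B)%E.
  by apply: integral_ge0 => w _; rewrite lee_fin expR_ge0.
have Ladd : semi_sigma_additive L.
  by apply: semi_sigma_additive_nng_induced => // w; rewrite lee_fin expR_ge0.
pose Lm : {measure set T -> \bar R} :=
  HB.pack L (isMeasure.Build _ _ _ L L0 L_ge0 Ladd).
move=> oA; rewrite -[LHS]/(Lm A).
apply: (g_sigma_algebra_measure_unique (rectangles Y n) _ (fun=> setT)) => //.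
- by move=> _ [C mC ->]; exact: measurable_rectangle.
- by move=> _; exact: rectangles_setT.
- by rewrite bigcup_const.
- exact: rectangles_setI.
- by move=> _ [C mC ->]; exact: change_of_measure_rectangle.
- move=> _.
  have [C mC ->] := rectangles_setT Y n.
  rewrite /Lm/= /L change_of_measure_rectangle// ltey_eq fin_num_measure//.
  exact: measurable_rectangle.
Qed.

End change_of_measure.

(** * Stopped sequences: change of measure and Wald's identity *)

Section stopping.
Context d (T : measurableType d) (R : realType) (Y : nat -> {mfun T >-> R}).
Variables (P Q : probability T R) (a b : nat -> R).
Hypotheses (gP : gaussian_sequence Y P a) (gQ : gaussian_sequence Y Q b).

Lemma integrable_llr_observation n :
  P.-integrable [set: T] (fun w => (llr (a n) (b n) (Y n w))%:E).
Proof.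
have ml := measurable_llr (a n) (b n).
apply/integrableP; split.
  by apply/measurable_EFinP; apply: measurableT_comp.
have /integrableP[_] := integrable_llr (a n) (b n).
apply: le_lt_trans.
rewrite (integral_gaussian_sequence gP n
  (f := fun y => `|(llr (a n) (b n) y)%:E|%E))//.
by apply: measurableT_comp => //; exact/measurable_EFinP.
Qed.

Lemma mean_llr_observation n :
  (\int[P]_w (llr (a n) (b n) (Y n w))%:E = ((a n - b n) ^+ 2 / 2)%:E)%E.
Proof.
rewrite -mean_llr.
have ml : measurable_fun [set: R] (fun y => (llr (a n) (b n) y)%:E).
  by apply/measurable_EFinP; exact: measurable_llr.
rewrite integralE [RHS]integralE; congr (_ - _)%E.
- rewrite -(integral_gaussian_sequence gP n)//; last exact: measurable_funepos.
  by apply: eq_integral => w _; rewrite !funeposE.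
- rewrite -(integral_gaussian_sequence gP n)//; last exact: measurable_funeneg.
  by apply: eq_integral => w _; rewrite !funenegE.
Qed.

Variables (N : nat) (sigma : T -> nat).
Hypothesis sigma_le : forall w, (sigma w <= N)%N.
Hypothesis sigma_stop : forall n, observed Y n [set w | sigma w = n].

Let running s : set T := [set w | (s < sigma w)%N].

Let observed_running s : observed Y s (running s).
Proof.
have -> : running s = ~` \bigcup_(k in `I_s.+1) [set w | sigma w = k].
  apply/seteqP; split => w /=.
    by move=> sw [k /= ks kw]; move: ks; rewrite -kw ltnS leqNgt sw.
  move=> H; rewrite /running/= ltnNge; apply/negP => ws; apply: H.
  by exists (sigma w).
apply: (@measurableC _ (obsType Y s)).
apply: (@bigcup_measurable _ (obsType Y s)) => k /=; rewrite ltnS => ks.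
exact: observed_mono ks _ _.
Qed.

Let measurable_running s : measurable (running s).
Proof. exact: (@observed_measurable _ _ _ Y s _ (@observed_running s)). Qed.

Let indic_running s w : \1_(running s) w = (s < sigma w)%N%:R :> R.
Proof.
by rewrite indicE; congr (nat_of_bool _)%:R; apply/idP/idP; rewrite inE.
Qed.

Definition stopped_llr w : R := cumulative_llr Y a b (sigma w) w.

Let stopped_llrE w : stopped_llr w =
  \sum_(s < N) \1_(running s) w * llr (a s) (b s) (Y s w).
Proof.
rewrite /stopped_llr /cumulative_llr.
rewrite (big_ord_widen N (fun s => llr (a s) (b s) (Y s w)))//.
rewrite big_mkcond/=; apply: eq_bigr => s _; rewrite indic_running.
by case: ifP; rewrite (mul0r, mul1r).
Qed.

Let sigmaE w : (sigma w)%:R = \sum_(s < N) \1_(running s) w :> R.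
Proof.
transitivity (\sum_(s < sigma w) (1 : R)).
  by rewrite sumr_const card_ord.
rewrite (big_ord_widen N (fun=> 1))// big_mkcond/=; apply: eq_bigr => s _.
by rewrite indic_running; case: ifP.
Qed.

Let integral_stopping_time :
  (\int[P]_w (sigma w)%:R%:E = \sum_(s < N) P (running s))%E.
Proof.
under eq_integral do rewrite sigmaE -sumEFin.
rewrite ge0_integral_sum//; last first.
  by move=> s; apply/measurable_EFinP; exact: measurable_indic.
by apply: eq_bigr => s _; rewrite integral_indic// setIT.
Qed.

Lemma fin_num_integral_stopping_time :
  (\int[P]_w (sigma w)%:R%:E \is a fin_num)%E.
Proof.
rewrite integral_stopping_time; apply/sum_fin_numP => s _ _.
exact: fin_num_measure.
Qed.

Let integrable_step s : P.-integrable [set: T]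
  (fun w => (\1_(running s) w * llr (a s) (b s) (Y s w))%:E).
Proof.
have := integrable_llr_observation s.
move/(integrableS measurableT (measurable_running s)) => /(_ (@subsetT _ _)).
rewrite integrable_mkcond//; apply: eq_integrable => // w _.
by rewrite patchE indicE; case: ifP => _; rewrite (mul0r, mul1r).
Qed.

Lemma integrable_stopped_llr : P.-integrable [set: T] (EFin \o stopped_llr).
Proof.
rewrite (_ : EFin \o stopped_llr = fun w =>
    \sum_(s < N) (\1_(running s) w * llr (a s) (b s) (Y s w))%:E)%E; last first.
  by apply/funext => w; rewrite /= stopped_llrE sumEFin.
by apply: integrable_sum => // s _; exact: integrable_step.
Qed.

(** The s-th increment of the log-likelihood has mean [kappa] and is independent
    of the event that the sequence is still running when it is added. *)
Lemma wald (kappa : R) : (forall s, (a s - b s) ^+ 2 / 2 = kappa) ->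
  (\int[P]_w (stopped_llr w)%:E = kappa%:E * \int[P]_w (sigma w)%:R%:E)%E.
Proof.
move=> kE; under eq_integral do rewrite stopped_llrE -sumEFin.
rewrite integral_sum// integral_stopping_time ge0_sume_distrr//.
apply: eq_bigr => s _.
have mV : measurable_fun [set: T] (llr (a s) (b s) \o Y s).
  by apply: measurableT_comp => //; exact: measurable_llr.
pose V := mfun_of mV.
transitivity (\int[P]_(w in running s) (V w)%:E)%E.
  rewrite [RHS]integral_mkcond; apply: eq_integral => w _.
  by rewrite patchE indicE; case: ifP => _; rewrite (mul0r, mul1r).
rewrite integral_setI_indep//.
- by rewrite mean_llr_observation kE muleC.
- exact: integrable_llr_observation.
- move=> B mB.
  apply: (gaussian_sequence_indep (B := llr (a s) (b s) @^-1` B) gP) => //.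
  by rewrite -[_ @^-1` _]setTI; exact: measurable_llr.
Qed.

Lemma measurable_stopped_llr : measurable_fun [set: T] stopped_llr.
Proof.
by apply/measurable_EFinP; exact: measurable_int integrable_stopped_llr.
Qed.

(** On the event that [sigma] equals n the stopped log-likelihood is the one of
    the first n observations, so the fixed-time formula applies piecewise. *)
Lemma change_of_measure_stopped (F : set T) :
  (forall n, observed Y n (F `&` [set w | sigma w = n])) ->
  (\int[P]_(w in F) (expR (- stopped_llr w))%:E = Q F)%E.
Proof.
move=> oF; pose Fn n := F `&` [set w | sigma w = n].
have FE : F = \big[setU/set0]_(n < N.+1) Fn n.
  rewrite -bigcup_mkord; apply/seteqP; split => w.
    by move=> Fw; exists (sigma w); rewrite /= ?ltnS.
  by move=> [n _ []].
have mFn n : measurable (Fn n).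
  exact: (@observed_measurable _ _ _ Y n _ (@oF n)).
have tF : trivIset [set: nat] Fn.
  apply/trivIsetP => i j _ _ /eqP ij; apply/seteqP; split => // w.
  move=> [[_ /= iw] [_ /= jw]].
  by apply: ij; rewrite -iw -jw.
rewrite [in LHS]FE ge0_integral_bigsetU//=; last 3 first.
- exact: index_enum_uniq.
- by move=> i j _ _ ij; apply/val_inj; exact: tF.
- apply: measurable_funTS; apply/measurable_EFinP.
  apply: measurableT_comp => //; apply: measurableT_comp => //.
  exact: measurable_stopped_llr.
rewrite [in RHS]FE measure_bigsetU//.
apply: eq_bigr => n _; apply: etrans (change_of_measure gP gQ (@oF n)).
by apply: eq_integral => w; rewrite inE => -[_ /= <-].
Qed.

(** * Testing between two Gaussian sequences *)

Local Notation Z := stopped_llr.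

(** The sigma-algebra of the stopping time [sigma]. *)
Let prior (F : set T) := forall n, observed Y n (F `&` [set w | sigma w = n]).

Let prior_measurable F : prior F -> measurable F.
Proof.
move=> oF; rewrite (_ : F = \bigcup_n (F `&` [set w | sigma w = n])).
  apply: bigcup_measurable => n _.
  exact: (@observed_measurable _ _ _ Y n _ (@oF n)).
by apply/seteqP; split => w; [move=> Fw; exists (sigma w)|move=> [n _ []]].
Qed.

(** Integrated over F, the inequality exp (r - Z) >= 1 + r - Z: the exponential
    weight becomes a probability under Q, and Z enters only linearly. *)
Lemma change_of_measure_tangent (F : set T) (r : R) : prior F ->
  (1 + r) * fine (P F) - \int[P]_(w in F) Z w <= expR r * fine (Q F).
Proof.
move=> oF; have mF := prior_measurable oF.
have iZF : P.-integrable F (EFin \o Z).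
  exact: (integrableS measurableT _ _ integrable_stopped_llr).
have mE : measurable_fun F (fun w => expR (- Z w)).
  apply: measurable_funTS; apply: measurableT_comp => //.
  apply: measurableT_comp => //.
  exact: measurable_stopped_llr.
have QF := change_of_measure_stopped oF.
have iE : P.-integrable F (EFin \o (fun w => expR (- Z w))).
  apply/integrableP; split; first exact/measurable_EFinP.
  under eq_integral do rewrite /= ger0_norm ?expR_ge0//.
  by rewrite QF ltey_eq fin_num_measure.
have ic : P.-integrable F (EFin \o cst (1 + r)).
  exact: finite_measure_integrable_cst.
rewrite -Rintegral_cst// -RintegralB// -{1}QF -/(Rintegral _ _ _).
rewrite -RintegralZl//.
apply: le_Rintegral => //.
- exact: (integrableB mF ic iZF).
- exact: (integrableZl mF _ iE).
move=> w _; rewrite -expRD; apply: le_trans (expR_ge1Dx _); lra.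
Qed.

(** The Donsker-Varadhan inequality for the function c 1_E.  The tangent line is
    taken at c on E and at 0 off E, where the bound Q (~` E) <= 1 cancels the
    constant terms. *)
Lemma error_tradeoff (kappa c : R) (E : set T) :
  (forall s, (a s - b s) ^+ 2 / 2 = kappa) -> prior E ->
  c * fine (P E) <=
  kappa * fine (\int[P]_w (sigma w)%:R%:E) + expR c * fine (Q E).
Proof.
move=> kE oE.
have mE := prior_measurable oE.
have oC : prior (~` E).
  move=> n; rewrite setIC -setDE (_ : _ `\` _ =
    [set w | sigma w = n] `\` (E `&` [set w | sigma w = n])).
    by apply: (@measurableD _ (obsType Y n)); [exact: sigma_stop|exact: oE].
  by apply/seteqP; split => w /=; tauto.
have mC := prior_measurable oC.
have h1 := change_of_measure_tangent c oE.
have h2 := change_of_measure_tangent 0 oC.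
have hZ : \int[P]_(w in E) Z w + \int[P]_(w in ~` E) Z w =
    kappa * fine (\int[P]_w (sigma w)%:R%:E).
  rewrite -Rintegral_setU// ?setUv//; last 2 first.
  - exact: integrable_stopped_llr.
  - exact/disj_setPCl.
  rewrite /Rintegral (wald kE) fineM//.
  exact: fin_num_integral_stopping_time.
have hC : fine (P (~` E)) = 1 - fine (P E).
  by rewrite probability_setC// fineB// fin_num_measure.
have hQ : fine (Q (~` E)) <= 1.
  by rewrite -lee_fin fineK ?fin_num_measure// probability_le1.
rewrite expR0 hC in h2; lra.
Qed.

End stopping.

(** * The exploration phase *)

Definition alternate (s : nat) : arm := if odd s then arm2 else arm1.

Section bandit.
Context d (Omega : measurableType d) (R : realType).
Variables (P : (arm -> R) -> probability Omega R).
Variables (X : arm -> nat -> {mfun Omega >-> R}).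

(** The reward that an exploration going on for ever would collect at time
    [s.+1]: before it, each arm has been pulled every other time. *)
Definition exploration (s : nat) : {mfun Omega >-> R} := X (alternate s) s./2.

Let slot (s : nat) : arm * nat := (alternate s, s./2).
Let time (i : arm * nat) : nat := (i.1 + i.2.*2)%N.

Let slotK : cancel slot time.
Proof.
move=> s; rewrite /slot /time /alternate /= -[RHS]odd_double_half.
by case: (odd s).
Qed.

Lemma exploration_gaussian mu : gaussian_bandit P X ->
  gaussian_sequence exploration (P mu) (fun s => mu (alternate s)).
Proof.
move=> /(_ mu)[law indep] n B mB.
pose J := [fset slot s | s in iota 0 n]%fset.
have -> : rectangle exploration n B =
    \bigcap_(i in [set` J]) (X i.1 i.2 @^-1` B (time i)).
  apply/seteqP; split => w H i /=.
    move=> /imfsetP[s /= + ->]; rewrite mem_iota add0n /= => sn.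
    by rewrite slotK; exact: H.
  move=> i_n; have := H (slot i); rewrite /= slotK; apply.
  by apply/imfsetP; exists i => //=; rewrite mem_iota add0n.
rewrite (indep _ (fun i => B (time i)))//.
rewrite eq_big_imfset/=; last by move=> s t _ _; exact: (can_inj slotK).
rewrite big_map undup_id ?iota_uniq// -[n in iota 0 n]subn0 big_mkord.
apply: eq_bigr => s _.
by rewrite slotK; exact: law.
Qed.

End bandit.

Lemma alternate_eq r s : (alternate r == alternate s) = (odd r == odd s).
Proof. by rewrite /alternate; case: (odd r); case: (odd s). Qed.

Lemma sum_same_parity s : (\sum_(r < s) (alternate r == alternate s) = s./2)%N.
Proof.
under eq_bigr do rewrite alternate_eq.
elim/ltn_ind: s => -[|[|s]] ih; rewrite ?big_ord0 ?big_ord_recr ?big_ord0//=.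
by rewrite !negbK eqxx ih//=; case: (odd s) => /=; lia.
Qed.

Lemma sum_alternate_even a k : (\sum_(r < k.*2) (alternate r == a) = k)%N.
Proof.
elim: k => [|k ih]; first by rewrite big_ord0.
rewrite doubleS !big_ord_recr/= ih /alternate/= odd_double/=.
by case: a {ih} => -[|[|//]] i /=; lia.
Qed.

Section etc.
Context d (Omega : measurableType d) (R : realType).
Variables (X : arm -> nat -> {mfun Omega >-> R}).
Variables (tau : Omega -> nat) (ahat : Omega -> arm).
Local Notation A := (etc_action tau ahat).
Local Notation Y := (exploration X).

Lemma etc_action_explore s w : (s < tau w)%N -> A s.+1 w = alternate s.
Proof. by rewrite /etc_action /alternate => ->/=; case: (odd s). Qed.

Lemma nb_past_pulls_explore a n w : (n <= tau w)%N ->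
  nb_past_pulls A a n.+1 w = (\sum_(r < n) (alternate r == a))%N.
Proof.
move=> n_tau; rewrite /nb_past_pulls big_add1/= big_mkord.
apply: eq_bigr => r _.
by rewrite etc_action_explore// (leq_trans (ltn_ord r)).
Qed.

Lemma reward_explore s w : (s < tau w)%N -> reward X A s.+1 w = Y s w.
Proof.
move=> s_tau; rewrite /reward etc_action_explore//.
by rewrite nb_past_pulls_explore ?sum_same_parity// ltnW.
Qed.

(** While exploration goes on, the rewards collected by the strategy are the
    exploration rewards.  This transfers the measurability of [tau] and [ahat],
    which refers to the rewards that the strategy itself produces, to a
    filtration independent of the strategy. *)
Lemma observed_history t (E D : set Omega) : history X A t E ->
  observed Y t D -> D `<=` [set w | (t <= tau w)%N] -> observed Y t (E `&` D).
Proof.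
move=> hE oD Dtau; move: E hE; apply: smallest_sub.
  split=> [|E oE|F oF].
  - by rewrite /= set0I; exact: (@measurable0 _ (obsType Y t)).
  - rewrite /= (_ : _ `&` D = D `\` (E `&` D)).
      exact: (@measurableD _ (obsType Y t)).
    by apply/seteqP; split => w /=; tauto.
  - rewrite /= setI_bigcupl.
    by apply: (@bigcup_measurable _ (obsType Y t)) => k _; exact: oF.
elim/big_ind: _ => // [U V HU HV E [/HU|/HV]//|s _ _ [B mB <-]] /=.
rewrite setTI (_ : _ `&` D = Y s @^-1` B `&` D).
  by apply: (@measurableI _ (obsType Y t)) => //; exact: observed_preimage.
apply/seteqP; split => w /= [Bw Dw]; split => //; move: Bw;
  by rewrite reward_explore// (leq_trans (ltn_ord s))//; exact: Dtau.
Qed.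

Hypothesis etc : is_etc X tau ahat.

Lemma observed_tau_geq t : observed Y t [set w | (t <= tau w)%N].
Proof.
have [tau_stop _ _] := etc.
elim: t => [|t ih].
  rewrite (_ : [set w | _] = setT); first exact: (@measurableT _ (obsType Y 0)).
  by apply/seteqP; split.
apply: (observed_mono (leqnSn t)).
rewrite (_ : [set w | (t < tau w)%N] = [set w | (t <= tau w)%N] `\`
    ([set w | (tau w <= t)%N] `&` [set w | (t <= tau w)%N])).
  by apply: (@measurableD _ (obsType Y t)) => //; exact: observed_history.
apply/seteqP; split => w /=; first by move=> tw; split; lia.
by move=> [tw]; case: (leqP (tau w) t) => //; lia.
Qed.

Lemma observed_tau_eq t : observed Y t [set w | tau w = t].
Proof.
have [tau_stop _ _] := etc.
rewrite (_ : [set w | _] =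
    [set w | (tau w <= t)%N] `&` [set w | (t <= tau w)%N]).
  by apply: observed_history => //; exact: observed_tau_geq.
by apply/seteqP; split => w /=; [move=> ->|move=> [? ?]; lia].
Qed.

Lemma observed_ahat a t :
  observed Y t (ahat @^-1` [set a] `&` [set w | tau w = t]).
Proof.
have [_ _ /(_ a t) ahat_stop] := etc.
rewrite (_ : _ `&` _ = (ahat @^-1` [set a] `&` [set w | (tau w <= t)%N])
     `&` [set w | (t <= tau w)%N]).
  by apply: observed_history => //; exact: observed_tau_geq.
by apply/seteqP; split => w /=;
  [move=> [? ->]|move=> [[? ?] ?]; split => //; lia].
Qed.

Lemma observed_minn N n : observed Y n [set w | minn (tau w) N = n].
Proof.
case: (ltngtP n N) => nN.
- rewrite (_ : [set w | _] = [set w | tau w = n]); first exact: observed_tau_eq.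
  by apply/seteqP; split => w /=; lia.
- rewrite (_ : [set w | _] = set0); first exact: (@measurable0 _ (obsType Y n)).
  by apply/seteqP; split => w //=; lia.
- rewrite (_ : [set w | _] = [set w | (n <= tau w)%N]).
    exact: observed_tau_geq.
  by apply/seteqP; split => w /=; lia.
Qed.

Lemma observed_commit a N n : observed Y n
  ([set w | (tau w <= N)%N /\ ahat w = a] `&` [set w | minn (tau w) N = n]).
Proof.
have [nN|Nn] := leqP n N.
  rewrite (_ : _ `&` _ = ahat @^-1` [set a] `&` [set w | tau w = n]).
    exact: observed_ahat.
  apply/seteqP; split => w /=; first by move=> [[? ?] ?]; split => //; lia.
  by move=> [? ?]; split => //; first split => //; lia.
rewrite (_ : _ `&` _ = set0); first exact: (@measurable0 _ (obsType Y n)).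
by apply/seteqP; split => w //= [_]; lia.
Qed.

Lemma measurable_tau_geq t : measurable [set w | (t <= tau w)%N].
Proof. exact: (@observed_measurable _ _ _ Y t _ (@observed_tau_geq t)). Qed.

Lemma measurable_ahat a : measurable (ahat @^-1` [set a]).
Proof.
rewrite (_ : _ @^-1` _ =
    \bigcup_t (ahat @^-1` [set a] `&` [set w | tau w = t])).
  apply: bigcup_measurable => t _.
  exact: (@observed_measurable _ _ _ Y t _ (@observed_ahat a t)).
by apply/seteqP; split => w; [move=> ?; exists (tau w)|move=> [t _ []]].
Qed.

Lemma measurable_etc_action t a : measurable [set w | A t w = a].
Proof.
rewrite (_ : [set w | _] =
   ([set w | (t <= tau w)%N] `&` [set w | (if odd t then arm1 else arm2) = a])
   `|` (ahat @^-1` [set a] `\` [set w | (t <= tau w)%N])).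
  apply: measurableU.
    apply: measurableI; first exact: measurable_tau_geq.
    have [e|ne] := pselect ((if odd t then arm1 else arm2) = a).
      rewrite (_ : [set _ | _] = setT)//; last by apply/seteqP; split.
    rewrite (_ : [set _ | _] = set0)//; last by apply/seteqP; split.
  by apply: measurableD; [exact: measurable_ahat|exact: measurable_tau_geq].
apply/seteqP; split => w /=; rewrite /etc_action; case: (leqP t (tau w)) => _.
- by left.
- by right.
- by case=> -[].
- by case=> -[].
Qed.

(** * Pulls and regret *)

Local Notation pulls a T w := (nb_past_pulls A a T.+1 w).

Lemma leq_pulls a m n w : (m <= n)%N -> (pulls a m w <= pulls a n w)%N.
Proof.
move=> mn.
by rewrite /nb_past_pulls [leqRHS](@big_cat_nat _ _ _ m.+1)//= leq_addr.
Qed.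

(** The exploration phase has even length, so both arms are pulled equally often
    in it. *)
Lemma pulls_explore a N T w : (N <= T)%N -> ~~ odd N ->
  (minn (tau w) N <= (pulls a T w).*2)%N.
Proof.
move=> NT evN; have [_ /(_ w) evtau _] := etc.
set m := minn _ _.
have evm : ~~ odd m by rewrite /m; case: leqP.
have mE : m = m./2.*2 by rewrite -[LHS]odd_double_half (negbTE evm).
have := leq_pulls a w (_ : m <= T)%N.
rewrite nb_past_pulls_explore ?geq_minl// mE sum_alternate_even => H.
rewrite leq_double; apply: H; rewrite -mE.
by apply: leq_trans NT; exact: geq_minr.
Qed.

Lemma pulls_commit N T w : (tau w <= N)%N -> (N <= T)%N ->
  (T - N <= pulls (ahat w) T w)%N.
Proof.
move=> tauN NT; rewrite /nb_past_pulls (@big_cat_nat _ _ _ N.+1)//=.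
apply: leq_trans (leq_addl _ _).
rewrite (eq_big_nat _ _ (F2 := fun=> 1%N)).
  by rewrite sum_nat_const_nat muln1 subSS.
move=> t /andP[Nt _]; rewrite /etc_action leqNgt (leq_ltn_trans tauN)//=.
by rewrite eqxx.
Qed.

End etc.

Lemma arm_neq (a b : arm) : a != b ->
  (a = arm1 /\ b = arm2) \/ (a = arm2 /\ b = arm1).
Proof.
rewrite -val_eqE/=; case: a => -[|[|//]] i; case: b => -[|[|//]] j //= _.
  by left; split; exact: val_inj.
by right; split; exact: val_inj.
Qed.

Lemma arm_other (a b c : arm) : a != b -> c != b -> c = a.
Proof. by move=> /arm_neq[[-> ->]|[-> ->]] /arm_neq[[-> //]|[-> //]]. Qed.

Lemma ge0_integral_lower_bound d (T : measurableType d) (R : realType)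
    (P : probability T R) (g : T -> R) (E : set T) (r : R) :
  P.-integrable [set: T] (EFin \o g) -> (forall w, 0 <= g w) -> measurable E ->
  (forall w, E w -> r <= g w) -> r * fine (P E) <= fine (\int[P]_w (g w)%:E).
Proof.
move=> ig g0 mE rg.
have igE : P.-integrable E (EFin \o g) by exact: (integrableS measurableT).
rewrite -Rintegral_cst//; apply: (@le_trans _ _ (\int[P]_(w in E) g w)).
  by apply: le_Rintegral => //; exact: finite_measure_integrable_cst.
apply: fine_le; [exact: integrable_fin_num|exact: integrable_fin_num|].
apply: ge0_subset_integral => //; last by move=> w _; rewrite lee_fin.
exact: measurable_int ig.
Qed.

Section regret.
Context d (Omega : measurableType d) (R : realType).
Variables (X : arm -> nat -> {mfun Omega >-> R}).
Variables (tau : Omega -> nat) (ahat : Omega -> arm).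
Hypothesis etc : is_etc X tau ahat.
Local Notation A := (etc_action tau ahat).
Local Notation pulls a T w := (nb_past_pulls A a T.+1 w).

Lemma integrable_pulls (P : probability Omega R) a T :
  P.-integrable [set: Omega] (fun w => (pulls a T w)%:R%:E).
Proof.
rewrite (_ : (fun w => _) =
    fun w => \sum_(t < T) (\1_[set w | A t.+1 w = a] w)%:E)%E.
  apply: integrable_sum => // t _.
  by apply: integrable_indic; exact: (measurable_etc_action etc).
apply/funext => w; rewrite sumEFin; congr EFin.
rewrite /nb_past_pulls big_add1/= big_mkord natr_sum; apply: eq_bigr => t _.
rewrite indicE; congr (nat_of_bool _)%:R.
by apply/eqP/idP; rewrite inE.
Qed.

Lemma sum_means (mu : arm -> R) (best worst : arm) T w : best != worst ->
  \sum_(1 <= t < T.+1) mu (A t w) =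
  T%:R * mu best - (mu best - mu worst) * (pulls worst T w)%:R.
Proof.
move=> bw; rewrite /nb_past_pulls natr_sum mulr_sumr.
rewrite (_ : T%:R * mu best = \sum_(1 <= t < T.+1) mu best); last first.
  by rewrite sumr_const_nat subn1 mulr_natl.
rewrite -sumrB; apply: eq_bigr => t _.
have [->|Aw] := eqVneq (A t w) worst; first by rewrite mulr1 opprB addrC subrK.
by rewrite mulr0 subr0 (arm_other bw Aw).
Qed.

Lemma regret_pulls (P : (arm -> R) -> probability Omega R) (mu : arm -> R)
    (best worst : arm) T : best != worst -> mu worst <= mu best ->
  regret P A mu T =
  (mu best - mu worst) * fine (\int[P mu]_w (pulls worst T w)%:R%:E).
Proof.
move=> bw le_mu; rewrite /regret unlock.
have -> : Num.max (mu arm1) (mu arm2) = mu best.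
  have [[b1 w2]|[b2 w1]] := arm_neq bw.
  - by rewrite -b1 -w2; exact/max_idPl.
  - by rewrite -b2 -w1; exact/max_idPr.
have ip := integrable_pulls (P mu) worst T.
have ic : (P mu).-integrable [set: Omega] (EFin \o cst (T%:R * mu best)).
  exact: finite_measure_integrable_cst.
under eq_integral do rewrite (sum_means mu T _ bw).
rewrite -/(Rintegral _ _ _) RintegralB//; last first.
  exact: (integrableZl measurableT _ ip).
rewrite Rintegral_cst// RintegralZl//.
rewrite [X in _ - (_ * fine X - _)](_ : _ = 1%E); last exact: probability_setT.
by rewrite mulr1 opprB addrC subrK.
Qed.

Lemma stopping_pulls (P : probability Omega R) a N T : (N <= T)%N -> ~~ odd N ->
  fine (\int[P]_w (minn (tau w) N)%:R%:E) <=
  2 * fine (\int[P]_w (pulls a T w)%:R%:E).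
Proof.
move=> NT evN; have ip := integrable_pulls P a T.
rewrite -[X in _ <= _ * X]/(Rintegral _ _ _) -RintegralZl//.
apply: fine_le; [|
  exact: (integrable_fin_num _ (integrableZl measurableT _ ip))|].
  apply: (@fin_num_integral_stopping_time _ _ _ (exploration X) P N).
    by move=> w; exact: geq_minr.
  exact: (observed_minn etc).
apply: ge0_le_integral => //.
- rewrite (_ : (fun w => _) =
    fun w => \sum_(s < N) (\1_[set w | (s < tau w)%N] w)%:E)%E.
    apply: emeasurable_sum => s; apply/measurable_EFinP/measurable_indic.
    exact: (measurable_tau_geq etc s.+1).
  apply/funext => w; rewrite sumEFin; congr EFin.
  transitivity (\sum_(s < minn (tau w) N) (1 : R)).
    by rewrite sumr_const card_ord.
  rewrite (big_ord_widen N (fun=> 1)) ?geq_minr// big_mkcond/=.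
  apply: eq_bigr => s _; rewrite indicE leq_min ltn_ord andbT.
  rewrite (_ : (w \in _) = (s < tau w)%N); first by case: ifP.
  by apply/idP/idP; rewrite inE.
- by apply: measurable_int; apply: (integrableZl measurableT _ ip).
- move=> w _; rewrite lee_fin -natrM ler_nat mul2n.
  exact: (pulls_explore etc).
Qed.

End regret.

(** * The alternative problem *)

Definition swap_means (R : realType) (mu : arm -> R) (a : arm) : R :=
  if a == arm1 then mu arm2 else mu arm1.

Lemma swap_means_neq (R : realType) (mu : arm -> R) (a b : arm) :
  a != b -> swap_means mu a = mu b.
Proof. by move=> /arm_neq[[-> ->]|[-> ->]]; rewrite /swap_means. Qed.

(** * The trade-off at a fixed horizon *)

Section finite_horizon.
Context d (Omega : measurableType d) (R : realType).
Variables (P : (arm -> R) -> probability Omega R).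
Variables (X : arm -> nat -> {mfun Omega >-> R}) (bandit : gaussian_bandit P X).
Variables (tau : Omega -> nat) (ahat : Omega -> arm) (etc : is_etc X tau ahat).
Variables (mu : arm -> R) (best worst : arm) (Delta : R).
Hypotheses (bw : best != worst) (Delta_gt0 : 0 < Delta).
Hypothesis muD : mu best - mu worst = Delta.
Local Notation A := (etc_action tau ahat).

(** The three terms of [error_tradeoff], for the exploration capped at time 2 M
    and the event that the strategy commits to [best] by then, bounded by the
    regrets under the two problems. *)
Lemma regret_tradeoff (T M : nat) (c : R) :
  (0 < M)%N -> (M * 4 <= T)%N -> 0 <= c ->
  c * (1 - regret P A mu T / (Delta * M%:R)) <=
  Delta * regret P A mu T +
  expR c * (regret P A (swap_means mu) T / (Delta * M%:R)).
Proof.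
move=> M0 MT c0.
set mu' := swap_means mu; set r := regret P A mu T; set r' := regret P A mu' T.
have wb : worst != best by rewrite eq_sym.
have mu'D : mu' worst - mu' best = Delta.
  by rewrite /mu' (swap_means_neq mu wb) (swap_means_neq mu bw).
pose k := fine (\int[P mu]_w (nb_past_pulls A worst T.+1 w)%:R%:E).
pose k' := fine (\int[P mu']_w (nb_past_pulls A best T.+1 w)%:R%:E).
have rE : r = Delta * k.
  by rewrite /r (regret_pulls etc P T bw) ?muD// -subr_ge0 muD ltW.
have r'E : r' = Delta * k'.
  by rewrite /r' (regret_pulls etc P T wb) ?mu'D// -subr_ge0 mu'D ltW.
pose N := M.*2; have NT : (N <= T)%N by rewrite /N; lia.
have evN : ~~ odd N by rewrite odd_double.
pose E : set Omega := [set w | (tau w <= N)%N /\ ahat w = best].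
have mE : measurable E.
  rewrite (_ : E = ahat @^-1` [set best] `\` [set w | (N < tau w)%N]).
    apply: measurableD; first exact: (measurable_ahat etc).
    exact: (measurable_tau_geq etc).
  apply/seteqP; split => w /=; first by move=> [h aw]; split => //=; lia.
  by move=> [aw h]; split => //; rewrite leqNgt; exact/negP.
have gap s : (mu (alternate s) - mu' (alternate s)) ^+ 2 / 2 = Delta ^+ 2 / 2.
  have [->|sb] := eqVneq (alternate s) best.
    by rewrite /mu' (swap_means_neq mu bw) muD.
  rewrite -muD /mu' (swap_means_neq mu sb).
  have [[s1 b1]|[s1 b1]] := arm_neq sb; have [[b2 w1]|[b2 w1]] := arm_neq bw;
    by [rewrite s1 b1 w1 -sqrrN opprB|rewrite b1 in b2].
have trade := error_tradeoff (exploration_gaussian mu bandit)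
  (exploration_gaussian mu' bandit) (fun w => geq_minr (tau w) N)
  (observed_minn etc N) c gap (observed_commit etc best N).
rewrite -/E in trade.
have stop := stopping_pulls etc (P mu) worst NT evN.
have ip := integrable_pulls etc.
have errP : M%:R * fine (P mu (~` E)) <= k.
  apply: (ge0_integral_lower_bound (ip _ _ _)) => //; first exact: measurableC.
  move=> w /= /not_andP Ew; rewrite ler_nat.
  have [tauN|Ntau] := leqP (tau w) N; last first.
    by have := pulls_explore etc worst w NT evN; rewrite /N; lia.
  have aw : ahat w = worst.
    case: Ew => // /eqP aw; exact: arm_other wb aw.
  by have := pulls_commit ahat tauN NT; rewrite aw /N; lia.
have errQ : M%:R * fine (P mu' E) <= k'.
  apply: (ge0_integral_lower_bound (ip _ _ _)) => //.
  move=> w [tauN aw]; rewrite ler_nat.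
  by have := pulls_commit ahat tauN NT; rewrite aw /N; lia.
have M_gt0 : 0 < M%:R :> R by rewrite ltr0n.
have -> : r / (Delta * M%:R) = k / M%:R.
  by rewrite rE; field; rewrite !gt_eqF.
have -> : r' / (Delta * M%:R) = k' / M%:R.
  by rewrite r'E; field; rewrite !gt_eqF.
have hP : 1 - k / M%:R <= fine (P mu E).
  have : fine (P mu (~` E)) <= k / M%:R by rewrite ler_pdivlMr// mulrC.
  by rewrite probability_setC// fineB//= ?fin_num_measure//; lra.
have hQ : fine (P mu' E) <= k' / M%:R by rewrite ler_pdivlMr// mulrC.
apply: (le_trans (ler_wpM2l c0 hP)); apply: (le_trans trade).
apply: lerD; last by rewrite ler_wpM2l// expR_ge0.
rewrite rE; apply: (le_trans (ler_wpM2l _ stop)).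
  by rewrite divr_ge0// sqr_ge0.
by rewrite -/k (_ : _ * (2 * k) = Delta * (Delta * k))//; field.
Qed.

End finite_horizon.

(** * Asymptotics *)

Lemma limn_einf_ge (R : realType) (u : nat -> \bar R) (x : \bar R) :
  (\forall n \near \oo, x <= u n)%E -> (x <= limn_einf u)%E.
Proof.
move=> [N _ Nu]; rewrite limn_einf_lim.
apply: lime_ge; first exact: is_cvg_einfs.
exists N => // n /= Nn; apply: le_ereal_inf_tmp => _ [m /= nm <-].
by apply: Nu; exact: leq_trans Nn nm.
Qed.

(** The trade-off for c = (1 - eps) L, where L stands for ln T: this makes
    exp c * exp (eps L) equal to T, so that a regret of order T^eps under the
    alternative contributes a bounded term. *)
Lemma regret_ln_lower_bound (R : realType) (Delta eps L r r' T M : R) :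
  0 < Delta -> 0 < eps < 1 -> 1 <= L -> 0 < T -> T / 8 <= M ->
  r <= eps * Delta / 8 * T -> r' <= eps * Delta / 8 * expR (eps * L) ->
  T = expR L ->
  ((1 - eps) * L) * (1 - r / (Delta * M)) <=
    Delta * r + expR ((1 - eps) * L) * (r' / (Delta * M)) ->
  (1 - 3 * eps) / Delta <= r / L.
Proof.
move=> D0 /andP[e0 e1] L1 T0 TM rT r'T TE trade.
have M0 : 0 < M by apply: lt_le_trans TM; rewrite divr_gt0.
have DM : 0 < Delta * M by rewrite mulr_gt0.
have h1 : r / (Delta * M) <= eps.
  rewrite ler_pdivrMr//; apply: (le_trans rT).
  by rewrite (_ : _ * T = eps * (Delta * (T / 8))); [rewrite !ler_pM2l|field].
have h2 : expR ((1 - eps) * L) * (r' / (Delta * M)) <= eps.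
  rewrite mulrA ler_pdivrMr//.
  apply: (le_trans (ler_wpM2l (expR_ge0 _) r'T)).
  rewrite mulrCA -expRD (_ : (1 - eps) * L + eps * L = L); last by ring.
  rewrite -TE (_ : _ * T = eps * (Delta * (T / 8))); first by rewrite !ler_pM2l.
  by field.
have h3 : (1 - eps) * L * (1 - eps) <= (1 - eps) * L * (1 - r / (Delta * M)).
  by apply: ler_wpM2l; [rewrite mulr_ge0; lra|lra].
rewrite ler_pdivlMr ?(lt_le_trans _ L1)// mulrAC ler_pdivrMr//.
have h4 : (1 - 3 * eps) * L <= (1 - eps) * L * (1 - eps) - eps by nra.
lra.
Qed.

Theorem theorem3 (R : realType) (d : measure_display) (Omega : measurableType d)
    (P : (arm -> R) -> probability Omega R)
    (X : arm -> nat -> {mfun Omega >-> R})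
    (bandit : gaussian_bandit P X)
    (Delta : R) (Delta_gt0 : 0 < Delta)
    (tau : nat -> Omega -> nat) (ahat : nat -> Omega -> arm)
    (etc : forall T : nat, is_etc X (tau T) (ahat T))
    (efficient : uniformly_efficient P (known_gap Delta)
                   (fun T => etc_action (tau T) (ahat T)))
    (mu : arm -> R) (mu_gap : known_gap Delta mu) :
  ((1 / Delta)%:E <=
   limn_einf (fun T : nat =>
     (regret P (etc_action (tau T) (ahat T)) mu T / ln T%:R)%:E))%E.
Proof.
have [best [worst [bw muD]]] :
    exists best worst : arm, best != worst /\ mu best - mu worst = Delta.
  have [le21|/ltW le12] := leP (mu arm2) (mu arm1).
    by exists arm1, arm2; split => //; rewrite -[LHS]ger0_norm ?subr_ge0.
  by exists arm2, arm1; split => //; rewrite -[LHS]ger0_norm ?subr_ge0// distrC.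
have swap_gap : known_gap Delta (swap_means mu).
  by rewrite /known_gap /= /swap_means/= distrC.
apply/lee_subgt0Pr => e e0; apply: limn_einf_ge.
pose eps := Num.min (e * Delta / 3) (1 / 2).
have eps0 : 0 < eps by rewrite lt_min divr_gt0 ?mulr_gt0//=; lra.
have eps1 : eps < 1 by rewrite /eps gt_min; apply/orP; right; lra.
have epse : 3 * eps / Delta <= e.
  by rewrite ler_pdivrMr// -ler_pdivlMl// mulrC ge_min lexx.
have c0 : 0 < eps * Delta / 8 by rewrite !mulr_gt0.
(* Exponent 1 suffices to make committing to [best] likely under [mu]; the
   alternative needs an exponent as small as the loss allowed. *)
have /eqoP/(_ _ c0) near1 := efficient mu mu_gap 1 ltr01.
have /eqoP/(_ _ c0) near2 := efficient _ swap_gap eps eps0.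
near=> T.
have T8 : (8 <= T)%N by near: T; exists 8%N.
have T0 : 0 < T%:R :> R by rewrite ltr0n; lia.
have L1 : 1 <= ln T%:R :> R.
  by rewrite -ler_expR lnK//; near: T; exact: nbhs_infty_ger.
rewrite -EFinB lee_fin; apply: (@le_trans _ _ ((1 - 3 * eps) / Delta)).
  by rewrite mulrBl lerB.
have trade := @regret_tradeoff _ _ _ _ _ bandit _ _ (etc T) mu best worst
  Delta bw Delta_gt0 muD T (T %/ 4) ((1 - eps) * ln T%:R).
apply: (regret_ln_lower_bound Delta_gt0 _ _ T0 _ _ _ _ (trade _ _ _)).
- by rewrite eps0.
- exact: L1.
- rewrite ler_pdivrMr// -natrM ler_nat; lia.
- have : `|regret P (etc_action (tau T) (ahat T)) mu T| <=
      eps * Delta / 8 * `|T%:R `^ 1| :> R by near: T.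
  rewrite powRr1 ?ler0n// (ger0_norm (ler0n _ _)); exact: le_trans (ler_norm _).
- have : `|regret P (etc_action (tau T) (ahat T)) (swap_means mu) T| <=
      eps * Delta / 8 * `|T%:R `^ eps| :> R by near: T.
  rewrite /powR gt_eqF// (ger0_norm (expR_ge0 _)); exact: le_trans (ler_norm _).
- by rewrite lnK.
- lia.
- lia.
- by rewrite mulr_ge0 ?subr_ge0 ?ltW// (lt_le_trans _ L1).
Unshelve. all: by end_near.
Qed.
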